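(* A tree $T$ is $(1,2,2)$-colorable if and only if $T$ does not contain (as a subgraph) a tree belonging to the family $\mathcal{T}$.
   Context: For a graph $G$ and a positive integer $d$, a $d$-packing is a set of vertices at pairwise distance greater than $d$. A graph $G$ is $(1,2,2)$-colorable if $V(G)$ can be partitioned into three (possibly empty) sets $X_1,X_2,X_3$ where $X_1$ is a $1$-packing (independent set) and $X_2,X_3$ are $2$-packings. Let $T_0$ be the tree consisting of a path $p_0p_1p_2p_3p_4$ together with three leaves attached to $p_1$, $p_2$ and $p_3$ respectively (8 vertices). Let $T_1$ be the tree consisting of a path $p_0p_1\cdots p_7$ together with four leaves attached to $p_1$, $p_2$, $p_5$ and $p_6$ respectively (12 vertices). The family $\mathcal{T}$ is defined recursively: (i) $T_0\in\mathcal{T}$ and $T_1\in\mathcal{T}$; (ii) if $T\in\mathcal{T}$ and $uv$ is an edge of $T$ with both $u$ and $v$ of degree $2$, then the tree obtained from $T$ by removing the edge $uv$, adding four new vertices $u_1,u_2,u_3,w$ and adding the edges $uu_1,u_1u_2,u_2u_3,u_3v,u_2w$ belongs to $\mathcal{T}$. *)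

(* Defs.v *)
From HB Require Import structures.
From mathcomp Require Import all_boot.

Set Implicit Arguments.
Unset Strict Implicit.
Unset Printing Implicit Defensive.

Record sgraph := SGraph {
  svertex :> finType;
  sedge : rel svertex;
  sedge_sym : symmetric sedge;
  sedge_irr : irreflexive sedge }.

Notation "x -- y" := (sedge x y) (at level 30, no associativity).

Definition degree (G : sgraph) (x : G) : nat := #|[set y | x -- y]|.

(* A one-vertex closed walk is excluded by irreflexivity and x, y, x is a
   duplicate-free [cycle] of size 2 in the sense of path.v, so the cycles of
   graph theory are the duplicate-free ones of size at least 3. *)
Definition is_tree (G : sgraph) : Prop :=
  [/\ 0 < #|G|,
      forall x y : G, connect (@sedge G) x y &
      forall s : seq G, 2 < size s -> ~ ucycle (@sedge G) s].

Definition walk (G : sgraph) (x y : G) (k : nat) : bool :=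
  [exists p : k.-tuple G, path (@sedge G) x p && (last x p == y)].

Lemma connect_walk (G : sgraph) (x y : G) :
  connect (@sedge G) x y -> exists k, walk x y k.
Proof.
move=> /connectP[p xp ->]; exists (size p); apply/existsP.
by exists (in_tuple p); rewrite xp eqxx.
Qed.

(* [None] is the infinite distance between distinct components. *)
Definition dist (G : sgraph) (x y : G) : option nat :=
  match @idP (connect (@sedge G) x y) with
  | ReflectT xy => Some (ex_minn (connect_walk xy))
  | ReflectF _ => None
  end.

Definition packing (G : sgraph) (d : nat) (X : {set G}) : Prop :=
  forall x y, x \in X -> y \in X -> x != y ->
    if dist x y is Some k then d < k else true.

Definition colorable122 (G : sgraph) : Prop :=
  exists X1 X2 X3 : {set G},
    [/\ X1 :|: X2 :|: X3 = [set: G],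
        [/\ [disjoint X1 & X2], [disjoint X1 & X3] & [disjoint X2 & X3]] &
        [/\ packing 1 X1, packing 2 X2 & packing 2 X3]].

(* [T] has a (not necessarily induced) subgraph isomorphic to [S]. *)
Definition contains (T S : sgraph) : Prop :=
  exists2 f : S -> T, injective f & {homo f : x y / x -- y}.

Section EdgeList.
Variables (n : nat) (l : seq (nat * nat)).

Definition edges_rel (i j : 'I_n) : bool :=
  (i != j) && (((val i, val j) \in l) || ((val j, val i) \in l)).

Lemma edges_rel_sym : symmetric edges_rel.
Proof. by move=> i j; rewrite /edges_rel eq_sym orbC. Qed.

Lemma edges_rel_irr : irreflexive edges_rel.
Proof. by move=> i; rewrite /edges_rel eqxx. Qed.

Definition edges_graph : sgraph := SGraph edges_rel_sym edges_rel_irr.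
End EdgeList.

(* p_i is vertex i, for i <= 4; the leaves are 5, 6, 7. *)
Definition T0 : sgraph := edges_graph 8
  [:: (0, 1); (1, 2); (2, 3); (3, 4); (1, 5); (2, 6); (3, 7)].

(* p_i is vertex i, for i <= 7; the leaves are 8, 9, 10, 11. *)
Definition T1 : sgraph := edges_graph 12
  [:: (0, 1); (1, 2); (2, 3); (3, 4); (4, 5); (5, 6); (6, 7);
      (1, 8); (2, 9); (5, 10); (6, 11)].

(* The new vertices u1, u2, u3, w are the elements 0, 1, 2, 3 of 'I_4. *)
Section Extension.
Variables (G : sgraph) (u v : G).

Definition ext_rel (a b : G + 'I_4) : bool :=
  match a, b with
  | inl x, inl y =>
      x -- y && ~~ ((x == u) && (y == v) || (x == v) && (y == u))
  | inl x, inr i | inr i, inl x =>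
      (x == u) && (val i == 0) || (x == v) && (val i == 2)
  | inr i, inr j => edges_rel [:: (0, 1); (1, 2); (1, 3)] i j
  end.

Lemma ext_rel_sym : symmetric ext_rel.
Proof.
move=> [x|i] [y|j] //=; last exact: edges_rel_sym.
by rewrite sedge_sym orbC ![(y == _) && _]andbC.
Qed.

Lemma ext_rel_irr : irreflexive ext_rel.
Proof. by move=> [x|i] /=; rewrite ?sedge_irr ?edges_rel_irr. Qed.

Definition ext_graph : sgraph := SGraph ext_rel_sym ext_rel_irr.
End Extension.

(* One representative of each isomorphism type reached by the recursion is
   enough, since [contains] is invariant under isomorphism. *)
Inductive familyT : sgraph -> Prop :=
| familyT0 : familyT T0
| familyT1 : familyT T1
| familyT_ext (T : sgraph) (u v : T) :
    familyT T -> u -- v -> degree u = 2 -> degree v = 2 ->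
    familyT (ext_graph u v).

(* Main.v *)
Require Import Defs.
From mathcomp Require Import all_boot.
From mathcomp Require Import zify.

(* In a colouring a vertex of degree at least 3 ("big") cannot have colour 1,
   and a vertex of colour 2 or 3 has at most one neighbour of colour other than
   1. So a neighbour z of n is kept from colour 1 ([forces n z]) if it is big, or
   if there is a path z, t, s with s big and s has a further neighbour kept from
   colour 1: were z of colour 1, both t and that neighbour would share s. A
   colouring thus excludes a [clash], a big vertex with two such neighbours.
   Conversely, in a tree without clash, colour downwards from a root, giving a
   child colour 1 unless this is excluded by its parent having colour 1 or by
   forcing. Finally, a clash in a tree spells out exactly a member of the
   family. *)

Set Implicit Arguments.
Unset Strict Implicit.
Unset Printing Implicit Defensive.

(** * Forcing, colourings, and why a colouring excludes a clash *)

Section Big.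
Variable G : sgraph.
Implicit Types x y z n s t r a b : G.

Lemma edgeC x y : x -- y = y -- x. Proof. exact: sedge_sym. Qed.

Lemma edge_neq x y : x -- y -> x != y.
Proof. by apply: contraTneq => ->; rewrite sedge_irr. Qed.

Definition big x := 2 < degree x.

Lemma big_intro x a b c :
  x -- a -> x -- b -> x -- c -> a != b -> a != c -> b != c -> big x.
Proof.
move=> xa xb xc ab ac bc; rewrite /big /degree.
have U : uniq [:: a; b; c] by rewrite /= !inE negb_or ab ac bc.
rewrite -[3]/(size [:: a; b; c]) -(card_uniqP U); apply/subset_leq_card/subsetP.
by move=> y; rewrite !inE => /or3P[] /eqP->.
Qed.

Lemma big_third x a b : big x -> exists c, [/\ x -- c, c != a & c != b].
Proof.
move=> bx; have : ~~ ([set y | x -- y] \subset [set a; b]).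
  by apply: contraL bx => /subset_leq_card S; rewrite -leqNgt
    (leq_trans S) // cards2; case: (_ == _).
by case/subsetPn=> c; rewrite !inE negb_or => xc /andP[ca cb]; exists c.
Qed.

Inductive forces : G -> G -> Prop :=
| forces_big n z : n -- z -> big z -> forces n z
| forces_step n z t s r :
    n -- z -> z -- t -> t -- s -> n != t -> z != s -> big s ->
    forces s r -> r != t -> forces n z.

Lemma forces_edge n z : forces n z -> n -- z.
Proof. by case. Qed.

Definition clash := exists n z1 z2,
  [/\ big n, z1 != z2, forces n z1 & forces n z2].

(** Relates [(n, z)] to [(s, r)] as in [forces_step]. Forcing thus becomes reachability in a finite
    relation, hence decidable, as the colouring procedure requires. *)
Definition fstep : rel (G * G) := fun e e' =>
  [&& e.1 -- e.2, big e'.1 &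
    [exists t, [&& e.2 -- t, t -- e'.1, e.1 != t, e.2 != e'.1 & e'.2 != t]]].

Definition forcesb n z :=
  [exists e : G * G, [&& connect fstep (n, z) e, e.1 -- e.2 & big e.2]].

Lemma forcesP n z : reflect (forces n z) (forcesb n z).
Proof.
apply: (iffP existsP) => [[e /and3P[/connectP[p]]]|].
  elim: p n z => [|[s r] p IH] n z /= => [_ -> /=|]; first exact: forces_big.
  case/andP=> /and3P[/= nz bs /existsP[t /and5P[zt ts nt zs rt]]] sp el ee be.
  exact: forces_step nz zt ts nt zs bs (IH _ _ sp el ee be) rt.
elim=> {n z} [n z nz bz|n z t s r nz zt ts nt zs bs _ [e /and3P[c ee be]] rt].
  by exists (n, z); rewrite connect0 nz bz.
exists e; rewrite ee be !andbT; apply: connect_trans c; apply: connect1.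
rewrite /fstep /= nz bs; apply/existsP; exists t.
by rewrite zt ts nt zs rt.
Qed.

(* [None] encodes the colour 1, [Some _] the two 2-packing colours. *)
Definition coloring (c : G -> option bool) :=
  (forall x y, x -- y -> c x <> c y) /\
  (forall x y z, x -- y -> x -- z -> y != z -> c y = c z -> c y = None).

Lemma distP x y (P : option nat -> Prop) :
  (forall k, walk x y k -> (forall m, walk x y m -> k <= m) -> P (Some k)) ->
  (~ connect (@sedge G) x y -> P None) -> P (dist x y).
Proof.
move=> PS PN; rewrite /dist.
(* The [match] on [idP] is dependent, so the boolean and its reflection proof are generalized
   together. *)
suff H (e : bool) (r : reflect (connect (@sedge G) x y) e) :
    P (match r with
       | ReflectT xy => Some (ex_minn (connect_walk xy))
       | ReflectF _ => None
       end) by exact: (H _ idP).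
by case: r => [xy|/PN //]; case: ex_minnP => k; apply: PS.
Qed.

Lemma dist_walk x y k : dist x y = Some k -> walk x y k.
Proof. by elim/distP: (dist x y) => // m wm _ [<-]. Qed.

Lemma walk_dist x y k : walk x y k -> exists2 m, dist x y = Some m & m <= k.
Proof.
move=> w; elim/distP: (dist x y) => [m _ /(_ k w) mk|[]]; first by exists m.
by case/existsP: w => p /andP[xp /eqP yp]; apply/connectP; exists p.
Qed.

Lemma packingP d (X : {set G}) : packing d X <->
  (forall x y k, x \in X -> y \in X -> x != y -> k <= d -> ~ walk x y k).
Proof.
split=> [P x y k xX yX xy kd /walk_dist[m Dm mk]|P x y xX yX xy].
  by have := P x y xX yX xy; rewrite Dm ltnNge (leq_trans mk).
case E: (dist x y) => [k|//]; rewrite ltnNge; apply/negP => kd.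
exact: P xX yX xy kd (dist_walk E).
Qed.

Lemma walk0 x y : walk x y 0 -> x = y.
Proof. by case/existsP=> p; rewrite tuple0 /= => /eqP. Qed.

Lemma walk1 x y : walk x y 1 = x -- y.
Proof.
apply/existsP/idP=> [[p]|xy]; last by exists [tuple y]; rewrite /= xy eqxx.
by case/tupleP: p => z p; rewrite tuple0 /= andbT => /andP[xz /eqP <-].
Qed.

Lemma walk2P x y : reflect (exists2 z, z -- x & z -- y) (walk x y 2).
Proof.
apply: (iffP existsP) => [[p]|[z zx zy]].
  case/tupleP: p => z p; case/tupleP: p => t p; rewrite tuple0 /= andbT.
  by case/andP=> /andP[xz zt] /eqP<-; exists z; rewrite // edgeC.
by exists [tuple z; y]; rewrite /= edgeC zx zy eqxx.
Qed.

(** Distinct vertices are within distance 2 exactly when they are adjacent or share a neighbour;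
    these are the two clauses of [coloring]. *)
Lemma colorable122P : colorable122 G <-> exists c, coloring c.
Proof.
split=> [[X1 [X2 [X3 [/setP XU _ [/packingP P1 /packingP P2 /packingP P3]]]]]|].
  pose c x := if x \in X1 then None else Some (x \in X2).
  have X3P x : x \notin X1 -> x \notin X2 -> x \in X3.
    by move=> x1 x2; have := XU x; rewrite !inE (negPf x1) (negPf x2).
  exists c; split=> [x y xy|x y z xy xz yz]; rewrite /c.
    have nxy := edge_neq xy; rewrite -walk1 in xy.
    case: ifPn => x1; case: ifPn => y1 e; [|done|done|].
      exact: P1 x1 y1 nxy _ xy.
    case: e; case: (boolP (x \in X2)) => x2; case: (boolP (y \in X2)) => y2 // _.
      exact: P2 x2 y2 nxy _ xy.
    exact: P3 (X3P _ x1 x2) (X3P _ y1 y2) nxy _ xy.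
  have w : walk y z 2 by apply/walk2P; exists x.
  case: ifPn => y1; case: ifPn => z1 e; [done|done|done|]; case: e.
  case: (boolP (y \in X2)) => y2; case: (boolP (z \in X2)) => z2 // _.
    by case: (P2 _ _ _ y2 z2 yz _ w).
  by case: (P3 _ _ _ (X3P _ y1 y2) (X3P _ z1 z2) yz _ w).
case=> c [c1 c2].
have P2 h : packing 2 [set x | c x == Some h].
  apply/packingP=> x y [|[|[|//]]]; rewrite !inE => /eqP cx /eqP cy xy _.
  - by move/walk0/eqP; rewrite (negPf xy).
  - by rewrite walk1 => /c1; rewrite cx cy.
  - by case/walk2P=> z zx zy; have := c2 _ _ _ zx zy xy; rewrite cx cy => /(_ erefl).
exists [set x | c x == None], [set x | c x == Some true],
  [set x | c x == Some false].
split; last split => //.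
- by apply/setP=> x; rewrite !inE; case: (c x) => [[]|].
- by split; rewrite -setI_eq0; apply/eqP/setP=> x; rewrite !inE; case: (c x) => [[]|].
apply/packingP=> x y [|[|//]]; rewrite !inE => /eqP cx /eqP cy xy _.
  by move/walk0/eqP; rewrite (negPf xy).
by rewrite walk1 => /c1; rewrite cx cy.
Qed.

Lemma coloring_clash c : coloring c -> ~ clash.
Proof.
case=> c1 c2.
(* Without colour 1, both neighbours of [x] would get the one packing colour that [x] lacks. *)
have tri x y z : x -- y -> x -- z -> y != z -> c x -> c y -> c z -> False.
  move=> xy xz yz.
  have := c1 _ _ xy; have := c1 _ _ xz; have := c2 _ _ _ xy xz yz.
  by case: (c x) (c y) (c z) => [[]|] [[]|] [[]|] // H1 H2 H3; have := H1 erefl.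
(* If [x] had colour 1, three of its neighbours would compete for two packing colours. *)
have cbig x : big x -> c x.
  case: (boolP (c x)) => // cx.
  have nb y : x -- y -> c y.
    by move=> xy; have := c1 _ _ xy; move: cx; case: (c x) (c y) => [?|] [?|].
  move=> bx.
  have [y [xy _ _]] := big_third x x bx.
  have [z [xz zy _]] := big_third y y bx.
  have [t [xt ty tz]] := big_third y z bx.
  have := c2 _ _ _ xz xy zy; have := c2 _ _ _ xt xy ty; have := c2 _ _ _ xt xz tz.
  have := nb _ xy; have := nb _ xz; have := nb _ xt.
  by case: (c y) (c z) (c t) => [[]|] [[]|] [[]|] // _ _ _ H1 H2 H3;
    first [by have := H1 erefl|by have := H2 erefl|by have := H3 erefl].
have cf n z : forces n z -> c z.
  elim=> {n z} [n z _ /cbig //|n z t s r nz zt ts nt zs bs fr cr rt].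
  case: (boolP (c z)) => // cz; case: (tri s r t) => //.
  - exact: forces_edge.
  - by rewrite edgeC.
  - exact: cbig.
  - by have := c1 _ _ zt; move: cz; case: (c z) (c t) => [?|] [?|].
case=> n [z1 [z2 [bn z12 f1 f2]]].
exact: tri (forces_edge f1) (forces_edge f2) z12 (cbig _ bn) (cf _ _ f1) (cf _ _ f2).
Qed.

End Big.

(** * Clashes in supergraphs and in the members of the family *)

Section Transfer.
Variables S T : sgraph.

Lemma big_map (f : S -> T) x :
  injective f -> (forall y, x -- y -> f x -- f y) -> big x -> big (f x).
Proof.
move=> fI fx bx.
have [y [xy _ _]] := big_third x x bx.
have [z [xz zy _]] := big_third y y bx.
have [t [xt ty tz]] := big_third y z bx.
by apply: (big_intro (fx _ xy) (fx _ xz) (fx _ xt));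
  rewrite (inj_eq fI) // eq_sym.
Qed.

(** Bigness and forcing ask only for edges to exist and vertices to differ, so they survive an
    injective homomorphism. *)
Lemma clash_contains : contains T S -> clash S -> clash T.
Proof.
case=> f fI fh.
have fb x : big x -> big (f x) by apply: big_map => // y; apply: fh.
have ff n z : forces n z -> forces (f n) (f z).
  elim=> {n z} [n z /fh nz /fb bz|n z t s r nz zt ts nt zs bs _ fr rt].
    exact: forces_big.
  by apply: (forces_step (fh _ _ nz) (fh _ _ zt) (fh _ _ ts) _ _ (fb _ bs) fr);
    rewrite (inj_eq fI).
case=> n [z1 [z2 [bn z12 f1 f2]]]; exists (f n), (f z1), (f z2).
by split; rewrite ?(inj_eq fI) //; [apply: fb|apply: ff|apply: ff].
Qed.

End Transfer.

Section ExtClash.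
Variables (G : sgraph) (u v : G).
Hypotheses (uv : u -- v) (du : degree u = 2) (dv : degree v = 2).
Let E := ext_graph u v.
Let new (i : 'I_4) : E := inr i.
Let u1 := new ord0.
Let u2 := new (@Ordinal 4 1 isT).
Let u3 := new (@Ordinal 4 2 isT).
Let w := new (@Ordinal 4 3 isT).
Let old (x : G) : E := inl x.

Lemma ext_big_old x : big x -> big (old x).
Proof.
move=> bx; apply: (big_map (f := old)) => // [? ? [] //|y xy].
rewrite /old /= xy; apply/negP=> /orP[] /andP[/eqP xE _];
  by move: bx; rewrite /big xE ?du ?dv.
Qed.

Lemma ext_big_new : big u2.
Proof. by apply: (@big_intro _ u2 u1 u3 w). Qed.

Lemma ext_edge x y : x -- y -> ~~ ((x == u) && (y == v) || (x == v) && (y == u)) ->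
  old x -- old y.
Proof. by move=> /= -> ->. Qed.

Lemma ext_edge_big x y : big x -> x -- y -> old x -- old y.
Proof.
move=> bx xy; apply: ext_edge xy _; apply/negP=> /orP[] /andP[/eqP xE _];
  by move: bx; rewrite /big xE ?du ?dv.
Qed.

(** The edges [n z] and [t s] have a big end, so they survive the extension. If [z t] is the removed
    edge, the step is replaced by two, the first arriving at the big vertex [u2] and the second
    leaving from it. *)
Lemma ext_forces n z : forces n z -> big n -> forces (old n) (old z).
Proof.
elim=> {n z} [n z nz bz|n z t s r nz zt ts nt zs bs fr IH rt] bn.
  by apply: forces_big; [exact: ext_edge_big|exact: ext_big_old].
have Enz := ext_edge_big bn nz.
have Ets : old t -- old s by rewrite edgeC; apply: ext_edge_big; rewrite // edgeC.
have fr' := IH bs.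
have [|nuv] := boolP ((z == u) && (t == v) || (z == v) && (t == u)); last first.
  exact: (forces_step Enz (ext_edge zt nuv) Ets nt zs (ext_big_old bs) fr' rt).
have b2 := ext_big_new.
case/orP=> /andP[/eqP zE /eqP tE]; subst z t.
  have f3 : forces u2 u3.
    apply: (@forces_step _ u2 u3 (old v) (old s) (old r)) => //=.
      by rewrite eqxx orbT.
    exact: ext_big_old.
  apply: (@forces_step _ (old n) (old u) u1 u2 u3) => //=.
  by rewrite eqxx.
have f1 : forces u2 u1.
  apply: (@forces_step _ u2 u1 (old u) (old s) (old r)) => //=.
    by rewrite eqxx.
  exact: ext_big_old.
apply: (@forces_step _ (old n) (old v) u3 u2 u1) => //=.
by rewrite eqxx orbT.
Qed.

Lemma ext_clash : clash G -> clash E.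
Proof.
case=> n [z1 [z2 [bn z12 f1 f2]]]; exists (old n), (old z1), (old z2).
by split; [exact: ext_big_old| |exact: ext_forces|exact: ext_forces].
Qed.

(** Together with [ext_degree_new]: the new edge from [u] to [u1] again joins two vertices of degree
    2, so the extension can be iterated there. *)
Lemma ext_degree_old : degree (old u) = 2.
Proof.
rewrite /degree (_ : [set y | _] = u1 |: old @: ([set y | u -- y] :\ v)).
  rewrite cardsU1 card_imset; last by move=> ? ? [].
  have := cardsD1 v [set y | u -- y]; rewrite inE uv.
  rewrite -[#|[set y | _]|]/(degree u) du => -[D].
  by rewrite -[#|_ :\ v|]add0n -D (_ : u1 \in _ = false) //; apply/imsetP => -[].
have nuv := edge_neq uv.
apply/setP=> -[y|i]; rewrite !inE.
  rewrite (mem_imset (f := old)) ?inE /=; last by move=> ? ? [].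
  rewrite eqxx (negPf nuv) /= orbF andbC; by [].
rewrite [X in _ || X](_ : _ = false) ?orbF; last by apply/imsetP => -[].
by rewrite /= eqxx (negPf nuv) /= orbF.
Qed.

Lemma ext_degree_new : degree u1 = 2.
Proof.
rewrite /degree (_ : [set y | _] = [set old u; u2]); first by rewrite cards2.
apply/setP=> -[y|[[|[|[|[|//]]]] ?]]; rewrite !inE //=.
by rewrite andbT andbF !orbF.
Qed.

End ExtClash.

Lemma edges_graph_edge n l (x y : edges_graph n l) :
  (x -- y) = (x != y) && (((val x, val y) \in l) || ((val y, val x) \in l)).
Proof. by []. Qed.

(** Both base trees clash at p_2, where p_1 is big. In [T0] the neighbour p_3 is big too; in [T1] it
    is forced through p_4 by the big vertices p_5 and p_6. *)
Lemma family_clash S : familyT S -> clash S.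
Proof.
elim=> [||G u v _ cG uv du dv]; last exact: ext_clash.
  pose o (i : nat) (h : i < 8) : T0 := Ordinal h.
  have b1 : big (@o 1 isT) by apply: (@big_intro _ _ (@o 0 isT) (@o 2 isT) (@o 5 isT)).
  have b2 : big (@o 2 isT) by apply: (@big_intro _ _ (@o 1 isT) (@o 3 isT) (@o 6 isT)).
  have b3 : big (@o 3 isT) by apply: (@big_intro _ _ (@o 2 isT) (@o 4 isT) (@o 7 isT)).
  by exists (@o 2 isT), (@o 1 isT), (@o 3 isT); split => //; apply: forces_big.
pose o (i : nat) (h : i < 12) : T1 := Ordinal h.
have b1 : big (@o 1 isT) by apply: (@big_intro _ _ (@o 0 isT) (@o 2 isT) (@o 8 isT)).
have b2 : big (@o 2 isT) by apply: (@big_intro _ _ (@o 1 isT) (@o 3 isT) (@o 9 isT)).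
have b5 : big (@o 5 isT) by apply: (@big_intro _ _ (@o 4 isT) (@o 6 isT) (@o 10 isT)).
have b6 : big (@o 6 isT) by apply: (@big_intro _ _ (@o 5 isT) (@o 7 isT) (@o 11 isT)).
exists (@o 2 isT), (@o 1 isT), (@o 3 isT); split => //; first exact: forces_big.
apply: (@forces_step _ _ _ (@o 4 isT) (@o 5 isT) (@o 6 isT)) => //.
exact: forces_big.
Qed.

(** * Parents and depths in a rooted tree *)

Section Rooted.
Variables (G : sgraph) (hT : is_tree G).
Implicit Types x y z r : G.

Definition away x : rel G := fun a b => [&& a -- b, a != x & b != x].

Lemma awayC x : connect_sym (away x).
Proof.
apply: sym_connect_sym => a b; rewrite /away edgeC.
by case: (b -- a); rewrite //= andbC.
Qed.

(** A simple path from [y] to [z] avoiding [x] would close up through [x] into a cycle. *)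
Lemma unique_away x y z : x -- y -> x -- z -> y != z -> ~~ connect (away x) y z.
Proof.
case: hT => _ _ acyc xy xz yz; apply/negP=> /connectP[p yp zp].
case/shortenP: yp zp => q yq Uq _ zq.
have [q0|q0] := eqVneq q [::]; first by rewrite zq q0 eqxx in yz.
have sq : path (@sedge G) y q by apply: sub_path yq => a b /and3P[].
have xq : x \notin y :: q.
  have : all (predC1 x) q.
    elim: q (y) yq {zq Uq q0 sq} => //= a q IH b /andP[/and3P[_ _ ax] /IH->].
    by rewrite ax.
  rewrite inE (negPf (edge_neq xy)) /= => /allP A.
  by apply/negP=> /A; rewrite /= eqxx.
apply: (acyc (x :: y :: q)); first by case: (q) q0.
rewrite /ucycle cons_uniq xq Uq /= xy rcons_path sq /= -zq andbT.
by rewrite edgeC.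
Qed.

Lemma walkS r y k : walk r y k.+1 -> exists2 x, walk r x k & x -- y.
Proof.
case/existsP=> -[p /= /eqP]; case/lastP: p => [//|p x]; rewrite size_rcons => -[sp].
rewrite rcons_path last_rcons => /andP[/andP[rp px] /eqP<-].
exists (last r p) => //; apply/existsP.
by exists (Tuple (introT eqP sp)); rewrite /= rp eqxx.
Qed.

Lemma walk_edge r x y k : walk r x k -> x -- y -> walk r y k.+1.
Proof.
case/existsP=> -[p /= sp] /andP[rp /eqP lp] xy; apply/existsP.
have sp' : size (rcons p y) == k.+1 by rewrite size_rcons.
by exists (Tuple sp'); rewrite /= rcons_path last_rcons rp lp xy eqxx.
Qed.

(** Take for [d] the distance from [r] and for [par x] a neighbour closer to [r]. Two neighbours of
    [x] no deeper than [x] both reach [r] while avoiding [x], so they are equal by [unique_away]. *)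
Lemma rooted r : exists (par : G -> G) (d : G -> nat),
  [/\ d r = 0,
      forall x, x != r -> x -- par x /\ d x = (d (par x)).+1 &
      forall x y, x -- y -> (x != r /\ y = par x) \/ (y != r /\ x = par y)].
Proof.
case: (hT) => _ conn _.
pose d x := ex_minn (connect_walk (conn r x)).
have dw x : walk r x (d x) by rewrite /d; case: ex_minnP.
have dmin x k : walk r x k -> d x <= k.
  by move=> w; rewrite /d; case: ex_minnP => m _; apply.
have dr : d r = 0.
  by apply/eqP; rewrite -leqn0 dmin //; apply/existsP; exists [tuple]; rewrite /= eqxx.
have d0 x : d x = 0 -> x = r by move=> dx; have := dw x; rewrite dx => /walk0.
have dS x y : x -- y -> d y <= (d x).+1 by move=> xy; apply/dmin/walk_edge/xy/dw.
pose par x := odflt x [pick y | (x -- y) && (d x == (d y).+1)].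
have parP x : x != r -> x -- par x /\ d x = (d (par x)).+1.
  move=> xr; rewrite /par; case: pickP => [y /andP[xy /eqP] //|].
  case E: (d x) => [|k]; first by rewrite (d0 _ E) eqxx in xr.
  have := dw x; rewrite E => /walkS[y ry yx] /(_ y).
  by rewrite edgeC yx /= eqSS eqn_leq (dmin _ _ ry) andbT -ltnS -E dS.
(* Climbing through parents strictly decreases the depth, so [x] is never met. *)
have up x y : d y <= d x -> y != x -> connect (away x) y r.
  move=> + yx; elim: {y}(d y) {-2 4}y yx (erefl (d y)) => [|k IH] y yx E kx.
    by rewrite (d0 _ (esym E)) connect0.
  have [yr|yr] := eqVneq y r; first by rewrite yr dr in E.
  have [yp] := parP y yr; rewrite -E => -[Ep].
  have px : par y != x by apply: contraTneq kx => <-; rewrite -Ep ltnn.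
  apply: connect_trans (IH _ px Ep (ltnW kx)).
  by apply: connect1; rewrite /away yp yx px.
have down x y : x -- y -> d y <= d x -> x != r /\ y = par x.
  move=> xy dyx; have xr : x != r.
    apply: contraTneq xy => xr; move: dyx.
    by rewrite xr dr leqn0 => /eqP/d0->; rewrite sedge_irr.
  split=> //; apply/eqP; case: (parP x xr) => xp dp; apply: contraT => yp.
  have /negP[] := unique_away xy xp yp.
  apply: connect_trans (up _ _ dyx _) _; first by rewrite eq_sym edge_neq.
  by rewrite awayC; apply: up; rewrite ?dp // eq_sym edge_neq.
exists par, d; split=> // x y xy.
have [dyx|dxy] := leqP (d y) (d x); first by left; apply: down.
by right; apply: down (ltnW dxy); rewrite edgeC.
Qed.

(* Rooted at its origin, a non-backtracking walk descends at every step. *)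
Lemma depth_from r : exists d : G -> nat,
  [/\ d r = 0, forall x, r -- x -> d x = 1 &
      forall x y z, x -- y -> y -- z -> x != z -> d y = (d x).+1 ->
        d z = (d y).+1].
Proof.
have [par [d [dr dp ed]]] := rooted r; exists d; split=> //.
  move=> x rx; case: (ed _ _ rx) => [[/eqP//]|[xr E]].
  by have [_ ->] := dp x xr; rewrite -E dr.
move=> x y z xy yz xz dy.
case: (ed _ _ yz) => [[yr zE]|[zr yE]]; last by rewrite (dp z zr).2 -yE.
case: (ed _ _ xy) => [[xr yE]|[_ xE]].
  by have := (dp x xr).2; rewrite -yE dy; lia.
by rewrite xE zE eqxx in xz.
Qed.

End Rooted.

(* In a rooted colouring the root and every child of a vertex coloured 1 are
   [Free]; the unique 2-packing-coloured child of a free vertex is [Tight], and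
   all its own children must be coloured 1. *)
Inductive state := One | Free | Tight.

(** * Colouring a tree without clash *)

Section Coloring.
Variables (G : sgraph) (hT : is_tree G) (nc : ~ clash G).
Implicit Types x y z r : G.

Lemma forcesV y z : forces y z -> big z \/
  exists t s q, [/\ z -- t, t -- s, y != t & z != s] /\
                [/\ big s, forces s q & q != t].
Proof.
case=> [y' z' _ bz|y' z' t s q _ zt ts yt zs bs fsq qt]; first by left.
by right; exists t, s, q.
Qed.

(** If [z] is not big, its only neighbours are [y] and [r], so the step forcing [z] goes through [r]
    to a big [s]. If [r] is big, there is a clash at [s]. Otherwise the step forcing [r] goes
    through [s], and the clash is at the big vertex it reaches. *)
Lemma forces_forces_big y z r : forces y z -> forces z r -> r != y -> big z.
Proof.
move=> fyz fzr ry; apply: contraT => nbz; case: nc.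
have zr := forces_edge fzr; have yz := forces_edge fyz.
have [bz|[t [s [q [[zt ts yt zs] [bs fsq qt]]]]]] := forcesV fyz.
  by rewrite bz in nbz.
have E : t = r.
  apply/eqP; apply: contraNT nbz => tr.
  by apply: (big_intro _ zt zr yt _ tr); rewrite 1?edgeC // eq_sym.
subst t; have [br|nbr] := boolP (big r).
  by exists s, q, r; split=> //; apply: forces_big => //; rewrite edgeC.
have [br|[t [s' [q' [[rt ts' zt' rs'] [bs' fsq' qt']]]]]] := forcesV fzr.
  by rewrite br in nbr.
have E : t = s.
  apply/eqP; apply: contraNT nbr => Ets.
  by apply: (big_intro _ rt ts zt' zs Ets); rewrite edgeC.
subst t; exists s', q', s; split=> //.
by apply: forces_big => //; rewrite edgeC.
Qed.

Lemma noclash_coloring : exists c : G -> option bool, coloring c.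
Proof.
(* The root has no parent to count among its neighbours; taking it big whenever some vertex is makes
   up for this in the clashes found below. *)
have [r rbig] : exists r : G, forall x, big x -> big r.
  have [x bx|nb] := pickP (@big G); first by exists x.
  by case: hT => /card_gt0P[r _] _ _; exists r => x; rewrite nb.
have [par [d [dr dp ed]]] := rooted hT r.
pose fix st (k : nat) (x : G) {struct k} : state := if k is k'.+1 then
  match st k' (par x) with
  | One => Free
  | Free => if forcesb (par x) x then Tight else One
  | Tight => One
  end else Free.
(* A vertex of colour 1 inherits its parent's hue, so that its child is given the hue opposite to
   that of the child's grandparent. *)
pose fix hue (k : nat) (x : G) {struct k} : bool := if k is k'.+1 then
  if st k x is One then hue k' (par x) else ~~ hue k' (par x) else true.
pose S x := st (d x) x; pose H x := hue (d x) x.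
have Sr : S r = Free by rewrite /S dr.
have SE x : x != r -> S x = match S (par x) with
  | One => Free | Free => if forcesb (par x) x then Tight else One
  | Tight => One end.
  by move=> xr; rewrite /S (dp x xr).2.
have HE x : x != r -> H x = if S x is One then H (par x) else ~~ H (par x).
  by move=> xr; rewrite /H /S (dp x xr).2.
have One_par x : S x = One -> x != r.
  by move=> Sx; apply: contraPneq Sx => ->; rewrite Sr.
have S1 x : S x = One -> ~ forces (par x) x.
  (* If the parent y of x is tight and forces x, then the path w, z, y, x above
     and including x forces w, so that w cannot have got colour 1 either. *)
  elim: {x}(d x) {-2}x (leqnn (d x)) => [|k IH] x dx Sx.
    by have := One_par x Sx => /dp[_ E]; rewrite E in dx.
  have xr := One_par x Sx; have [xy dxy] := dp x xr.
  have := SE x xr; rewrite Sx; case Sy: (S (par x)) => //; last first.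
    move=> _; set y := par x in xy dxy Sy *.
    have yr : y != r by apply: contraPneq Sy => ->; rewrite Sr.
    have [yz dyz] := dp y yr.
    have := SE y yr; rewrite Sy; case Sz: (S (par y)) => //.
    case: forcesP => // fzy _ fyx; set z := par y in yz dyz Sz fzy *.
    have xz : x != z by apply/eqP=> E; rewrite E in dxy; lia.
    have by' := forces_forces_big fzy fyx xz.
    have [zr|zr] := eqVneq z r.
      case: nc; exists y, x, z; split=> //.
      by apply: forces_big => //; rewrite zr; apply: rbig by'.
    have [zw dzw] := dp z zr.
    have := SE z zr; rewrite Sz; case Sw: (S (par z)) => //; last first.
      by case: forcesP.
    move=> _; set w := par z in zw dzw Sw *.
    have wr := One_par _ Sw.
    have [wv dwv] := dp w wr.
    apply: (IH w _ Sw); first by lia.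
    apply: (@forces_step _ _ _ z y x) => //; rewrite 1?edgeC //.
      by apply/eqP=> E; rewrite -E in dzw dwv *; lia.
    by apply/eqP=> E; rewrite E in dzw; lia.
  by case: forcesP.
(* A vertex of colour 1 has at most one child: with its parent, two children would make it big,
   hence forced. *)
have nbig x y z : S x = One -> x -- y -> x -- z -> y != par x -> z != par x ->
    y != z -> False.
  move=> Sx xy xz yp zp yz; have [xp _] := dp x (One_par x Sx).
  apply: (S1 x Sx); apply: forces_big; first by rewrite edgeC.
  by apply: (big_intro xp xy xz) => //; rewrite eq_sym.
pose c x := if S x is One then None else Some (H x).
have adj x : x != r -> c x <> c (par x).
  move=> xr; rewrite /c (HE x xr) (SE x xr); case: (S (par x)) => //.
  by case: forcesP => // _ []; case: (H _).
have far x z : z != r -> x = par z -> x != r -> c z = c (par x) -> c z = None.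
  move=> zr xE xr; rewrite /c (HE z zr) (SE z zr) -xE (HE x xr) (SE x xr).
  case: (S (par x)) => //; last by case: (H _) => -[].
  by case: forcesP => // _; case: (H _) => -[].
exists c; split=> [x y xy|x y z xy xz yz].
  case: (ed _ _ xy) => [[xr ->]|[yr ->]]; first exact: adj.
  by move/esym; apply: adj.
case: (ed _ _ xy) => [[xr yE]|[yr xE]]; case: (ed _ _ xz) => [[xr' zE]|[zr xE']].
- by rewrite yE zE eqxx in yz.
- by rewrite yE => E; rewrite E; apply: (far x z).
- by rewrite zE; apply: (far x y).
have ypar : x != r -> y != par x.
  by move=> xr; apply/eqP=> E; have := (dp x xr).2; rewrite -E (dp y yr).2 -xE; lia.
have zpar : x != r -> z != par x.
  by move=> xr; apply/eqP=> E; have := (dp x xr).2; rewrite -E (dp z zr).2 -xE'; lia.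
rewrite /c (SE y yr) (SE z zr) -xE -xE'; case Sx: (S x) => //.
  by have xr := One_par x Sx; case: (nbig x y z Sx xy xz (ypar xr) (zpar xr) yz).
case: forcesP => // fy; case: forcesP => // fz _.
(* Two forced children clash at [x]. It is big because its parent is a third neighbour or, at the
   root, because forcing exhibits some big vertex. *)
case: nc; exists x, y, z; split=> //; have [xr|xr] := eqVneq x r.
  rewrite xr; case: fy => [? u _|? ? ? u ? _ _ _ _ _ + _ _]; exact: rbig.
by have [xp _] := dp x xr; apply: (big_intro xp xy xz); rewrite // eq_sym ?ypar ?zpar.
Qed.

End Coloring.

(* The members of the family are the caterpillars [spider k]: a path
   p_0 ... p_(3k+1) with a leaf at p_i for every [i] in [leg k]. The pair
   [(i, false)] stands for p_i and [(i, true)] for the leaf at p_i. *)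
Definition leg k i := [|| i == 1, i == 3 * k | (i %% 3 == 2) && (i < 3 * k)].

Definition spider_vertex k (a : nat * bool) : bool :=
  (a.1 <= (3 * k).+1) && (a.2 ==> leg k a.1).

Definition spider_edge (a b : nat * bool) : bool :=
  match a, b with
  | (i, false), (j, false) => (j == i.+1) || (i == j.+1)
  | (i, _), (j, _) => (i == j) && (a != b)
  end.

(** An injective homomorphism into the caterpillar suffices for a tree containing the caterpillar to
    contain [S]. *)
Definition labelling (S : sgraph) k (phi : S -> nat * bool) : Prop :=
  [/\ injective phi, forall x, spider_vertex k (phi x) &
      forall x y, x -- y -> spider_edge (phi x) (phi y)].

Lemma spider_edgeC : symmetric spider_edge.
Proof. by case=> [i []] [j []] /=; rewrite ?xpair_eqE; lia. Qed.

Lemma labelling_edges_graph n l k (phi : nat -> nat * bool) :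
  uniq (map phi (iota 0 n)) -> all (spider_vertex k) (map phi (iota 0 n)) ->
  all (fun e => spider_edge (phi e.1) (phi e.2)) l ->
  labelling k (fun x : edges_graph n l => phi (val x)).
Proof.
move=> U /allP V /allP El.
have sI (x : 'I_n) : val x \in iota 0 n by rewrite mem_iota ltn_ord.
split=> [x y E|x|x y].
- have nE (z : 'I_n) : phi (val z) = nth (0, false) (map phi (iota 0 n)) (val z).
    by rewrite (nth_map 0) ?size_iota ?ltn_ord // nth_iota ?ltn_ord.
  by apply/val_inj/eqP; rewrite -(nth_uniq (0, false) _ _ U) ?size_map
    ?size_iota ?ltn_ord // -!nE E.
- by apply: V; apply: map_f.
- rewrite edges_graph_edge => /andP[_ /orP[/El //|/El]].
  by rewrite spider_edgeC.
Qed.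

(** The induction starts at [T1], the caterpillar of index 2. Extending at p_3 p_4 shifts the later
    indices by 3 and inserts p_4, p_5, p_6 and a leaf at p_5. The first new edge is the next p_3
    p_4, so the induction carries that edge along. *)
Lemma spider_family k : exists S : sgraph, familyT S /\
  exists phi : S -> nat * bool, labelling k.+2 phi /\
  exists u v, [/\ u -- v, degree u = 2 & degree v = 2] /\
    phi u = (3, false) /\ phi v = (4, false).
Proof.
elim: k => [|k [S [FS [phi [[phiI phiV phiE] [u [v [[uv du dv] [pu pv]]]]]]]]].
  exists T1; split; first exact: familyT1.
  pose f i := if i < 8 then (i, false) else
    (nth 0 [:: 1; 2; 5; 6] (i - 8), true).
  exists (fun x => f (val x)); split; first exact: labelling_edges_graph.
  exists (@Ordinal 12 3 isT), (@Ordinal 12 4 isT); split=> //; split=> //.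
    rewrite /degree (_ : [set y | _] =
      [set (@Ordinal 12 2 isT); (@Ordinal 12 4 isT)]) ?cards2 //.
    by apply/setP=> -[[|[|[|[|[|[|[|[|[|[|[|[|//]]]]]]]]]]]] ?]; rewrite !inE.
  rewrite /degree (_ : [set y | _] =
      [set (@Ordinal 12 3 isT); (@Ordinal 12 5 isT)]) ?cards2 //.
  by apply/setP=> -[[|[|[|[|[|[|[|[|[|[|[|[|//]]]]]]]]]]]] ?]; rewrite !inE.
exists (ext_graph u v); split; first exact: familyT_ext.
pose shift (a : nat * bool) := (if a.1 < 4 then a.1 else a.1 + 3, a.2).
pose psi (x : ext_graph u v) := match x with
  | inl x => shift (phi x)
  | inr i => if val i == 3 then (5, true) else (4 + val i, false)
  end.
exists psi; split; last first.
  exists (inl u), (inr ord0); rewrite /psi pu; split=> //; split.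
  - by rewrite /= !eqxx.
  - exact: ext_degree_old.
  - exact: ext_degree_new.
have sI : injective shift.
  case=> [i b] [j c]; rewrite /shift /= => -[+ ->] => E; congr (_, _).
  by move: E; case: ifP => ?; case: ifP => ?; lia.
have sN x : exists b, shift (phi x) = (b, (phi x).2) /\ (b < 4 \/ 6 < b).
  rewrite /shift; exists (if (phi x).1 < 4 then (phi x).1 else (phi x).1 + 3).
  by split=> //; case: ifP => ?; lia.
split.
- move=> [x|i] [y|j] /=.
  + by move/sI/phiI ->.
  + have [b [-> hb]] := sN x; have := ltn_ord j.
    by case: ifP => ? ? [? _]; lia.
  + have [b [-> hb]] := sN y; have := ltn_ord i.
    by case: ifP => ? ? [? _]; lia.
  + move=> E; congr inr; apply: val_inj; move: E => /=.
    by case: ifP => ?; case: ifP => ? E; first [done|lia|case: E; lia].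
- move=> [x|[i hi]] /=.
    have := phiV x; rewrite /spider_vertex /shift /leg; case: (phi x) => i b /=.
    case: b => /=; rewrite ?implybT ?andbT; case: ifP => ?; lia.
  by case: ifP => ?; rewrite /spider_vertex /leg /=; lia.
have half x i : @ext_rel S u v (inl x) (inr i) ->
    spider_edge (psi (inl x)) (psi (inr i)).
  by move=> /= /orP[] /andP[/eqP-> /eqP->]; rewrite ?pu ?pv.
move=> [x|i] [y|j]; last first.
- by case: i j => [[|[|[|[|//]]]] ?] [[|[|[|[|//]]]] ?].
- by rewrite edgeC spider_edgeC; apply: half.
- exact: half.
case/andP=> /phiE exy nuv; rewrite /= /shift.
have u_of z : phi z = (3, false) -> z = u by rewrite -pu => /phiI.
have v_of z : phi z = (4, false) -> z = v by rewrite -pv => /phiI.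
move: exy (u_of x) (u_of y) (v_of x) (v_of y) nuv.
case: (phi x) (phi y) => [i b] [j c] E ux uy vx vy.
(* The shift separates the ends of p_3 p_4 only, and this is the removed edge. *)
have [E1|n1] := boolP ((i == 3) && (j == 4) && ~~ b && ~~ c).
  case/andP: E1 => /andP[/andP[/eqP Ei /eqP Ej]] /negbTE Eb /negbTE Ec; subst.
  by rewrite ux // vy // !eqxx.
have [E1|n2] := boolP ((i == 4) && (j == 3) && ~~ b && ~~ c).
  case/andP: E1 => /andP[/andP[/eqP Ei /eqP Ej]] /negbTE Eb /negbTE Ec; subst.
  by rewrite uy // vx // !eqxx orbT.
move=> _; case: b c E n1 n2 {ux uy vx vy} => [] [] /=;
  rewrite ?xpair_eqE /= ?andbT ?andbF //;
  case: ifP => ?; case: ifP => ?; lia.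
Qed.

(** * Embedding a caterpillar along a walk in a tree *)

Section Embed.
Variables (T : sgraph) (hT : is_tree T) (k : nat) (p : nat -> T).
Hypothesis p_edge : forall i, i <= 3 * k -> p i -- p i.+1.
Hypothesis p_nonback : forall i, i < 3 * k -> p i != p i.+2.
Hypothesis p_big : forall i, leg k i -> big (p i).

(** A walk that never turns back moves away from its start at every step in a tree, so its vertices
    and the chosen leaves are pairwise distinct. *)
Lemma spider_contains (S : sgraph) (phi : S -> nat * bool) :
  0 < k -> labelling k phi -> contains T S.
Proof.
move=> k0 [phiI phiV phiE].
(* A big vertex has a neighbour besides the two on the walk, so the default [p i] is never taken at
   a leg. *)
have [lf lfP] : exists lf : nat -> T, forall i, leg k i ->
    [/\ p i -- lf i, lf i != p i.-1 & lf i != p i.+1].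
  exists (fun i =>
    odflt (p i) [pick y | [&& p i -- y, y != p i.-1 & y != p i.+1]]) => i.
  move/p_big/big_third => /(_ (p i.-1) (p i.+1))[c [pc c1 c2]].
  by case: pickP => [y /and3P[]//|/(_ c)]; rewrite pc c1 c2.
pose g (a : nat * bool) := if a.2 then lf a.1 else p a.1.
(* Depth is measured from the image of smaller index; a coincidence would put the other image at
   depth 0. *)
have gE i b j c : spider_vertex k (i, b) -> spider_vertex k (j, c) -> i <= j ->
    g (i, b) = g (j, c) -> (i, b) = (j, c).
  move=> Vi Vj ij; have [d [d0 d1 dS]] := depth_from hT (g (i, b)).
  (* Starting from a leaf costs one more edge, hence the summand [b]. Two consecutive depths are
     carried because [dS] needs the previous step. *)
  have dp m : (i + m <= (3 * k).+1 -> d (p (i + m)) = m + b) /\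
      (i + m <= 3 * k -> d (p (i + m).+1) = m.+1 + b).
    elim: m => [|m [IH1 IH2]].
      rewrite addn0; have Ei : d (p i) = b.
        case: b Vi d0 d1 => // /andP[_ /lfP[pl _ _]] _ d1.
        by apply: d1; rewrite /g /= edgeC.
      split=> // ik; case: b Vi d0 d1 Ei => /= [/andP[_ /lfP[pl _ ln]] d0 _ Ei|_ _ d1 _].
        have pi := p_edge ik; rewrite edgeC in pl.
        have dl : d (lf i) = 0 := d0.
        rewrite (dS _ _ _ pl pi ln); first by rewrite Ei.
        by rewrite Ei dl.
      by apply: d1; apply: p_edge.
    rewrite addnS; split=> // ik.
    have im : i + m <= 3 * k := ltnW ik.
    have d2 : d (p (i + m).+1) = (d (p (i + m))).+1.
      by rewrite IH2 // IH1 // (leq_trans im).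
    by rewrite (dS _ _ _ (p_edge im) (p_edge ik) (p_nonback ik) d2) IH2.
  move=> Eg; have dj : d (g (j, c)) = 0 by rewrite -Eg.
  have [m jE] : exists m, j = i + m by exists (j - i); lia.
  subst j; case: c Vj Eg dj => [/andP[/= Vj1 /lfP[pl ln _]]|/andP[/= Vj1 _]] Eg dj.
    case: m {ij} ln Vj1 pl Eg dj => [|m] ln Vj1 pl Eg dj.
      rewrite addn0 in pl Eg dj *; case: b Vi d0 d1 dS dp Eg => // _ _ d1 _ _ _.
      by move: dj; rewrite /g /= d1.
    move: dj; rewrite /g /= (dS (p (i + m)) (p (i + m.+1))) //.
    - by rewrite addnS p_edge //; lia.
    - by rewrite eq_sym; move: ln; rewrite addnS.
    - by rewrite (dp m.+1).1 // (dp m).1 //; lia.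
  move: dj; rewrite /g /= (dp m).1 // => /eqP; rewrite addn_eq0 => /andP[/eqP-> /eqP].
  by rewrite addn0; case: (b).
exists (g \o phi) => [x y|x y xy] /=.
  move: (phiV x) (phiV y) => Vx Vy E; apply: phiI.
  case: (phi x) (phi y) Vx Vy E => [i b] [j c] Vx Vy E.
  have [ij|ji] := leqP i j; first exact: gE.
  by apply/esym/gE => //; apply: ltnW.
have := phiE _ _ xy; move: (phiV x) (phiV y).
case: (phi x) (phi y) => [i []] [j []] /andP[/= Vi Li] /andP[/= Vj Lj]; rewrite /g /=.
- by rewrite xpair_eqE eqxx andbT => /andP[->].
- by case/andP=> /eqP<- _; have [pl _ _] := lfP _ Li; rewrite edgeC.
- by case/andP=> /eqP-> _; have [pl _ _] := lfP _ Lj.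
case/orP=> /eqP E; subst; first exact: p_edge.
by rewrite edgeC; apply: p_edge.
Qed.
End Embed.

(** * From a clash to a member of the family *)

Section Clash.
Variables (T : sgraph) (hT : is_tree T).
Implicit Types x y z n : T.

(** Each [forces_step] puts three vertices in front of the chain from [s], whence big vertices at
    the multiples of 3; the final [forces_big] supplies the one at 3m+1. *)
Lemma forces_chain n z : forces n z -> big n ->
  exists m (q : nat -> T), [/\ q 0 = n, q 1 = z,
    forall i, i <= 3 * m -> q i -- q i.+1,
    forall i, i < 3 * m -> q i != q i.+2 &
    (forall j, j <= m -> big (q (3 * j))) /\ big (q (3 * m).+1)].
Proof.
elim=> {n z} [n z nz bz|n z t s r nz zt ts nt zs bs _ IH rt] bn.
  exists 0, (fun i => if i is 0 then n else z); split=> //.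
    by case.
  by split=> // -[].
have [m [q [q0 q1 qe qn [qb ql]]]] := IH bs.
exists m.+1, (fun i => match i with 0 => n | 1 => z | 2 => t | i.+3 => q i end).
split=> //.
- by case=> [|[|[|i]]] //= ik; [rewrite q0|apply: qe; clear -ik; lia].
- case=> [|[|[|i]]] //= ik; first by rewrite q0.
    by rewrite q1 eq_sym.
  by apply: qn; clear -ik; lia.
split; last by rewrite mulnS add3n.
by case=> [|j] //; rewrite mulnS add3n => /qb.
Qed.

(* Walking along a forcing chain turns the opposite one around, until it
   reaches the big vertex at which the first chain ends. *)
Lemma clash_turn n z : forces n z -> big n -> forall z', z' != z -> forces n z' ->
  exists x y y', [/\ big x, x -- y, big y, forces y y' & y' != x].
Proof.
elim=> {n z} [n z nz bz|n z t s r nz zt ts nt zs bs fsr IH rt] bn z' z'z fz'.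
  by exists z, n, z'; split=> //; rewrite edgeC.
apply: (IH bs t); first by rewrite eq_sym.
apply: (@forces_step _ s t z n z') => //; rewrite 1?edgeC 1?eq_sym //.
Qed.

Lemma clash_family : clash T -> exists S : sgraph, familyT S /\ contains T S.
Proof.
case=> n [z [z' [bn zz' fz fz']]].
have [x [y [y' [bx xy by' fy yx]]]] :
    exists x y y', [/\ big x, x -- y, big y, forces y y' & y' != x].
  by apply: (clash_turn fz bn _ fz'); rewrite eq_sym.
have [m [q [q0 q1 qe qn [qb ql]]]] := forces_chain fy by'.
have [a [xa ay _]] := big_third y y bx.
have [b [qlb bq _]] := big_third (q (3 * m)) (q (3 * m)) ql.
(* The chain is preceded by [x] and a further neighbour [a] of [x], and followed by a further
   neighbour [b] of its last vertex. The shift by 2 sends multiples of 3 to indices congruent to 2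
   modulo 3, and 3m+1 to 3(m+1). *)
pose p i := match i with
  | 0 => a | 1 => x | i.+2 => if i <= (3 * m).+1 then q i else b end.
have pe i : i <= 3 * m.+1 -> p i -- p i.+1.
  case: i => [|[|i]] /= ik; first by rewrite edgeC.
    by rewrite q0.
  case: ltnP => im; first by rewrite (ltnW im) qe.
  have -> : i = (3 * m).+1 by clear -im ik; lia.
  by rewrite leqnn.
have pn i : i < 3 * m.+1 -> p i != p i.+2.
  case: i => [|[|i]] /= ik; first by rewrite q0.
    by rewrite q1 eq_sym.
  have im : i <= 3 * m by clear -ik; lia.
  rewrite (leq_trans im) //; case: ltnP => im'; first by rewrite qn.
  have -> : i = 3 * m by clear -im im'; lia.
  by rewrite eq_sym.
have pb i : leg m.+1 i -> big (p i).
  case/or3P=> [/eqP-> //|/eqP->|/andP[/eqP i2 im]].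
    by rewrite mulnS add3n /= leqnn.
  have Ei := divn_eq i 3; rewrite i2 mulnC addn2 in Ei.
  by rewrite Ei /= ifT; [apply: qb|]; move: im; rewrite Ei; clear; lia.
(* A chain with [m] equal to 0 spells [T0], which lies outside the range of [spider_family]. *)
case: m {q0 q1 qe qn qb ql qlb bq} @p pe pn pb => [|m] p pe pn pb.
  exists T0; split; first exact: familyT0.
  pose f i := if i < 5 then (i, false) else (i - 4, true).
  apply: (spider_contains hT pe pn pb (phi := fun x : T0 => f (val x))) => //.
  exact: labelling_edges_graph.
have [S [FS [phi [Lphi _]]]] := spider_family m.
by exists S; split=> //; apply: (spider_contains hT pe pn pb _ Lphi).
Qed.

End Clash.

Theorem theorem2p2 (T : sgraph) (hT : is_tree T) :
  colorable122 T <-> ~ (exists S : sgraph, familyT S /\ contains T S).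
Proof.
split=> [/colorable122P[c /coloring_clash nc] [S [FS TS]]|nS].
  exact: nc (clash_contains TS (family_clash FS)).
by apply/colorable122P/(noclash_coloring hT) => /(clash_family hT).
Qed.
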